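(* Let $ABC$ be a circular segment less than a semicircle of a circle with center $O$, with base $AC$, vertex $B$ and diameter $BD$, and let $BP$ be the diameter of the circle through $B$. Let $G$ be the point between $O$ and $P$ on $BP$ such that $$OG^2 = BD\cdot PD.$$ Draw through $G$ the line segment $KH$ parallel to $AC$, with $KH = AC$ and with $G$ the midpoint of $KH$. Then the barycenter of the figure that combines (as a union) the circular segment $ABC$ with the triangle $KOH$ is the center $O$ of the circle.
   Context: A circular segment $ABC$ is the plane region enclosed by an arc of a circle with endpoints $A$, $C$ and the chord (base) $AC$; it is less than a semicircle if its arc is shorter than a semicircle. Its vertex $B$ is the midpoint of the arc; its diameter $BD$ is the straight segment from $B$ to the midpoint $D$ of $AC$. The barycenter is the centroid of the plane region with uniform density. *)

(* Defs.v *)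
From HB Require Import structures.
From mathcomp Require Import all_boot all_order all_algebra.
From mathcomp Require Import all_classical all_reals all_analysis.
Set Implicit Arguments.
Unset Strict Implicit.
Unset Printing Implicit Defensive.
Import Order.TTheory GRing.Theory Num.Theory numFieldNormedType.Exports.
Local Open Scope classical_set_scope.
Local Open Scope ring_scope.

Section PlaneGeometry.
Variable R : realType.

Implicit Types (p q u v c X Y Z : R * R) (r s t : R) (E : set (R * R)).

(* The library norm on R * R is the sup norm, hence an explicit Euclidean
   distance. *)
Definition dist p q : R :=
  Num.sqrt ((p.1 - q.1) ^+ 2 + (p.2 - q.2) ^+ 2).

Definition midpoint p q : R * R := (1 / 2) *: (p + q).

Definition parallel p q u v : Prop :=
  (q.1 - p.1) * (v.2 - u.2) = (q.2 - p.2) * (v.1 - u.1).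

Definition segment p q : set (R * R) :=
  [set x | exists2 l : R, 0 <= l <= 1 & x = (1 - l) *: p + l *: q].

Definition triangle X Y Z : set (R * R) :=
  [set x | exists a b c : R, [/\ 0 <= a, 0 <= b, 0 <= c, a + b + c = 1 &
    x = a *: X + b *: Y + c *: Z]].

Definition circle c r : set (R * R) := [set x | dist c x = r].

Definition is_diameter c r p q : Prop :=
  [/\ circle c r p, circle c r q & segment p q c].

Definition circle_point c r t : R * R := (c.1 + r * cos t, c.2 + r * sin t).

(* The arc swept from angle s to angle t, in whichever direction; it is a
   simple proper arc when 0 < |t - s| < 2 pi. *)
Definition circle_arc c r s t : set (R * R) :=
  [set circle_point c r u | u in [set u | Num.min s t <= u <= Num.max s t]].

Definition arc_length r s t : R := r * `|t - s|.

Definition semicircle_length r : R := pi * r.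

Definition arc_midpoint c r s t : R * R := circle_point c r ((s + t) / 2).

(* The closed region enclosed by the curve E: the points of E (whose component
   in the complement of E is empty by convention) and the points in the bounded
   components of the complement of E. *)
Definition enclosed E : set (R * R) :=
  [set p | bounded_set (connected_component (~` E) p)].

Definition circular_segment c r s t : set (R * R) :=
  enclosed
    (circle_arc c r s t `|` segment (circle_point c r s) (circle_point c r t)).

(* The points of the plane, equipped with the sigma-algebra on which the
   library defines the (product) Lebesgue measure. *)
Definition area :
    {measure set (measurableTypeR R * measurableTypeR R) -> \bar R} :=
  (@lebesgue_measure R \x @lebesgue_measure R)%E.

(* The regularity conditions ensure that no quotient below is a default value
   of [fine] or of division. *)
Definition is_barycenter
    (E : set (measurableTypeR R * measurableTypeR R)) (g : R * R) : Prop :=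
  [/\ measurable E, (0 < area E < +oo)%E,
      area.-integrable E (fun p => p.1%:E),
      area.-integrable E (fun p => p.2%:E) &
      g = ((\int[area]_(p in E) p.1) / fine (area E),
           (\int[area]_(p in E) p.2) / fine (area E))].

End PlaneGeometry.

(* Main.v *)
(** In coordinates [(u, v)] centred at [O] with the [u]-axis along [OB], put
    [c = r cos d] and [a = r sin d], where [2 d] is the angle of the arc, so
    that [c ^ 2 + a ^ 2 = r ^ 2].  Since [BD * PD = (r - c) (r + c) = a ^ 2], the
    triangle is [- a <= u <= - |v|], while the segment is
    [c <= u, u ^ 2 + v ^ 2 <= r ^ 2].  For [|v| <= a] the line at height [v] cuts
    the figure in [[- a, - |v|]] and [[c, sqrt (r ^ 2 - v ^ 2)]], whose first
    moment is [((v ^ 2 - a ^ 2) + (r ^ 2 - v ^ 2 - c ^ 2)) / 2 = 0]; the sections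
    at constant [u] are symmetric.  By Fubini both moments about [O] vanish.

    The change of coordinates preserves area because a plane rotation is a
    product of shears, each of which translates every line of a parallel
    family. *)
Require Import Defs.
From HB Require Import structures.
From mathcomp Require Import all_boot all_order all_algebra.
From mathcomp Require Import all_classical all_reals all_analysis.
From mathcomp Require Import measurable_realfun ring lra.
Import Order.TTheory GRing.Theory Num.Theory numFieldNormedType.Exports.
Local Open Scope classical_set_scope.
Local Open Scope ring_scope.

(** * Area-preserving maps *)

Section AreaPreservingMaps.
Context {R : realType}.
Local Notation plane := (measurableTypeR R * measurableTypeR R)%type.

(** By uniqueness of Lebesgue measure: its pushforward along a translation gives every half-open
    interval its length. *)
Lemma lebesgue_measure_translation (a : R) (X : set (measurableTypeR R)) :
  measurable X ->
  lebesgue_measure ((fun x : measurableTypeR R => (x + a : measurableTypeR R)) @^-1` X)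
  = lebesgue_measure X.
Proof.
pose f (x : measurableTypeR R) : measurableTypeR R := x + a.
have mf : measurable_fun setT f by exact: measurable_funD.
pose mf' := isMeasurableFun.Build _ _ _ _ f mf.
pose F : {mfun (measurableTypeR R) >-> (measurableTypeR R)} := HB.pack f mf'.
move=> mX; symmetry.
apply: (@lebesgue_measure_unique R (pushforward lebesgue_measure F)) => // _ [[u v] _ <-].
have E : F @^-1` `]u, v] = `](u - a), (v - a)]%classic.
  by apply/seteqP; split => x /=; rewrite !in_itv/= /f ltrBlDr lerBrDr.
transitivity (@lebesgue_measure R `](u - a), (v - a)]); last by rewrite -E.
rewrite !lebesgue_measure_itv/= !lte_fin ltrD2r.
by case: ifP => // _; rewrite -!EFinD; congr EFin; ring.
Qed.

(** Phrased with preimages: the pushforward of [area] along [f] is [area] itself. *)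
Definition area_preserving (f : plane -> plane) :=
  measurable_fun setT f /\
  forall X, measurable X -> area R (f @^-1` X) = area R X.

Lemma area_preserving_comp f g :
  area_preserving f -> area_preserving g -> area_preserving (g \o f).
Proof.
move=> [mf ff] [mg gg]; split; first exact: measurableT_comp.
move=> X mX; rewrite comp_preimage ff ?gg//.
by rewrite -[X in measurable X]setTI; exact: mg.
Qed.

(** [area] integrates the lengths of the x-sections; the iterated measure in the other order agrees
    with it on rectangles, hence everywhere. Shears along the first axis need this order. *)
Lemma area_ysection (X : set plane) : measurable X ->
  area R X = (\int[lebesgue_measure]_y lebesgue_measure (ysection X y))%E.
Proof.
move=> mX; rewrite -[RHS]/((lebesgue_measure \x^ lebesgue_measure)%E X).
apply: product_measure_unique => // A B mA mB.
exact: product_measure2E.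
Qed.

(** Each horizontal line is translated by a constant, so every y-section keeps its length. *)
Lemma area_preserving_shear1 (h : R -> R) :
  measurable_fun (setT : set (measurableTypeR R)) (h : measurableTypeR R -> measurableTypeR R) ->
  area_preserving (fun p => (p.1 + h p.2, p.2)).
Proof.
move=> mh.
have mf : measurable_fun (setT : set plane)
    (fun p : plane => (p.1 + h p.2, p.2) : plane).
  apply: measurable_fun_pair => //.
  apply: measurable_funD => //.
  exact: (measurableT_comp mh).
split=> // X mX; rewrite !area_ysection//; last first.
  by rewrite -[X in measurable X]setTI; exact: mf.
apply: eq_integral => y _.
rewrite -(lebesgue_measure_translation (h y) _ (measurable_ysection y mX)).
by congr lebesgue_measure; apply/seteqP; split=> x /=; rewrite !ysectionE.
Qed.

Lemma area_preserving_shear2 (h : R -> R) :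
  measurable_fun (setT : set (measurableTypeR R)) (h : measurableTypeR R -> measurableTypeR R) ->
  area_preserving (fun p => (p.1, p.2 + h p.1)).
Proof.
move=> mh.
have mf : measurable_fun (setT : set plane)
    (fun p : plane => (p.1, p.2 + h p.1) : plane).
  apply: measurable_fun_pair => //.
  apply: measurable_funD => //.
  exact: (measurableT_comp mh).
split=> // X mX.
apply: eq_integral => x _.
rewrite -[RHS](lebesgue_measure_translation (h x) _ (measurable_xsection x mX)).
rewrite -[LHS]/(lebesgue_measure (xsection _ x)).
by congr lebesgue_measure; apply/seteqP; split=> y /=; rewrite !xsectionE.
Qed.

Lemma area_preserving_translation (a b : R) :
  area_preserving (fun p => (p.1 + a, p.2 + b)).
Proof.
exact: (area_preserving_comp _ _
  (area_preserving_shear1 _ (measurable_cst a))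
  (area_preserving_shear2 _ (measurable_cst b))).
Qed.

(* With unit determinant and [c != 0] the matrix is a product of three shears,
   as in Gaussian elimination; the case [c = 0] reduces to it by a quarter
   turn. *)
Lemma area_preserving_linear (a b c d : R) : a * d - b * c = 1 ->
  area_preserving (fun p => (a * p.1 + b * p.2, c * p.1 + d * p.2)).
Proof.
have mmul (k : R) : measurable_fun (setT : set (measurableTypeR R))
    (fun x : measurableTypeR R => (k * x : measurableTypeR R)).
  exact: measurable_funM.
have shears (a' b' c' d' : R) : c' != 0 -> a' * d' - b' * c' = 1 ->
    area_preserving (fun p => (a' * p.1 + b' * p.2, c' * p.1 + d' * p.2)).
  move=> c0 det.
  have := area_preserving_comp _ _ (area_preserving_comp _ _
    (area_preserving_shear1 _ (mmul ((d' - 1) / c')))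
    (area_preserving_shear2 _ (mmul c')))
    (area_preserving_shear1 _ (mmul ((a' - 1) / c'))).
  congr area_preserving; apply/funext => -[x y] /=.
  have -> : b' = (a' * d' - 1) / c' by rewrite -det; field.
  by congr pair; field.
move=> det; have [c0|c0] := eqVneq c 0; last exact: shears.
move: det; rewrite c0 mulr0 subr0 => ad.
have d0 : - d != 0.
  by rewrite oppr_eq0; apply: contra_eq_neq ad => ->; rewrite mulr0 eq_sym oner_neq0.
have quarter : area_preserving (fun p => (0 * p.1 + -1 * p.2, 1 * p.1 + 0 * p.2)).
  by apply: shears; [exact: oner_neq0|ring].
have rest : area_preserving (fun p => (- b * p.1 + a * p.2, - d * p.1 + 0 * p.2)).
  by apply: shears => //; rewrite -ad; ring.
have := area_preserving_comp _ _ quarter rest.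
congr area_preserving; apply/funext => -[x y] /=.
by congr pair; ring.
Qed.

End AreaPreservingMaps.

(** * Barycenters and sections *)

Section Barycenters.
Context {R : realType}.
Local Notation plane := (measurableTypeR R * measurableTypeR R)%type.
Implicit Types (X : set plane) (l : plane -> R).

Lemma integral_area_preserving (f : plane -> plane) X l :
  area_preserving f -> measurable X -> measurable_fun setT l ->
  (area R).-integrable X (EFin \o l) ->
  (area R).-integrable (f @^-1` X) (EFin \o (l \o f)) /\
  \int[area R]_(p in f @^-1` X) l (f p) = \int[area R]_(q in X) l q.
Proof.
move=> [mf ff] mX ml /integrableP[mlX lX].
have mlE : measurable_fun setT (EFin \o l) by exact/measurable_EFinP.
have mfX : measurable (f @^-1` X) by rewrite -[X in measurable X]setTI; exact: mf.
have lf : (area R).-integrable (f @^-1` X) ((EFin \o l) \o f).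
  apply/integrableP; split.
    by apply: measurable_funTS; exact: measurableT_comp.
  have mlabs : measurable_fun X (abse \o (EFin \o l)).
    by apply: measurable_funTS; exact: measurableT_comp.
  have := ge0_integral_pushforward mf (area R) mX mlabs (fun _ _ => abse_ge0 _).
  rewrite (eq_measure_integral (area R)); last by move=> A mA _; exact: ff.
  by move=> <-.
split => //; congr fine.
rewrite -(integral_pushforward mf mlE lf mX).
by apply: eq_measure_integral => A mA _; exact: ff.
Qed.

(** The second hypothesis recovers [p] from [f p] by an affine map. Coordinates are thus affine
    functions of [f p], and change of variables with linearity of the integral carries the
    barycenter along. *)
Lemma is_barycenter_preimage (f : plane -> plane) (g b : R * R)
    (a1 b1 a2 b2 : R) X :
  area_preserving f ->
  (forall p, p = (g.1 + (a1 * (f p).1 + b1 * (f p).2),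
                  g.2 + (a2 * (f p).1 + b2 * (f p).2)) :> R * R) ->
  is_barycenter X b ->
  is_barycenter (f @^-1` X) (g.1 + (a1 * b.1 + b1 * b.2), g.2 + (a2 * b.1 + b2 * b.2)).
Proof.
move=> apf fK [mX areaX i1 i2 ->] /=.
have [mf ff] := apf.
have mfX : measurable (f @^-1` X) by rewrite -[X in measurable X]setTI; exact: mf.
have areaE : area R (f @^-1` X) = area R X by exact: ff.
have area0 : fine (area R X) != 0 by rewrite gt_eqF// fine_gt0.
(* One coordinate at a time: the constant [k] integrates to [k] times the area, which the
   normalisation turns back into [k]. *)
have coord (k a b' : R) : let l (q : plane) := k + (a * q.1 + b' * q.2) in
    (area R).-integrable (f @^-1` X) (EFin \o (l \o f)) /\
    (\int[area R]_(p in f @^-1` X) l (f p)) / fine (area R X) =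
    k + (a * ((\int[area R]_(q in X) q.1) / fine (area R X)) +
         b' * ((\int[area R]_(q in X) q.2) / fine (area R X))).
  move=> l.
  have ia : (area R).-integrable X (EFin \o (fun q : plane => a * q.1)).
    by have := integrableZl mX a i1.
  have ib : (area R).-integrable X (EFin \o (fun q : plane => b' * q.2)).
    by have := integrableZl mX b' i2.
  have iab : (area R).-integrable X (EFin \o (fun q : plane => a * q.1 + b' * q.2)).
    by have := integrableD mX ia ib.
  have ik : (area R).-integrable X (EFin \o (fun=> k)).
    apply: measurable_bounded_integrable => //; first by case/andP: areaX.
    by exists `|k|; split=> [|M /ltW kM q _]; rewrite ?normr_real.
  have il : (area R).-integrable X (EFin \o l).
    by have := integrableD mX ik iab.
  have ml : measurable_fun setT l.
    apply: measurable_funD => //.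
    by apply: measurable_funD; apply: measurable_funM.
  have [ilf ->] := integral_area_preserving f X l apf mX ml il.
  split => //.
  rewrite RintegralD// RintegralD// !RintegralZl// Rintegral_cst//.
  by field.
have [j1 e1] := coord g.1 a1 b1.
have [j2 e2] := coord g.2 a2 b2.
split; rewrite ?areaE //.
- apply: eq_integrable j1 => // p _; congr EFin.
  exact: esym (congr1 fst (fK p)).
- apply: eq_integrable j2 => // p _; congr EFin.
  exact: esym (congr1 snd (fK p)).
- rewrite -e1 -e2; congr pair; congr (_ / _); apply: eq_Rintegral => p _.
  + exact: esym (congr1 fst (fK p)).
  + exact: esym (congr1 snd (fK p)).
Qed.

(** Fubini for [l] extended by zero outside [X]. *)
Lemma integral_xsection X l : measurable X -> (area R).-integrable X (EFin \o l) ->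
  (forall x : R, \int[lebesgue_measure]_(y in xsection X x) (l (x, y))%:E = 0)%E ->
  \int[area R]_(p in X) l p = 0.
Proof.
move=> mX il l0; rewrite /Rintegral integral_mkcond.
rewrite -(integral12_prod_meas1 (m1 := lebesgue_measure) (m2 := lebesgue_measure)); last first.
  exact/(integrable_mkcond _ mX).
rewrite integral0_eq// => x _; rewrite -[RHS](l0 x) [RHS]integral_mkcond.
apply: eq_integral => y _; rewrite /fubini_F /patch.
by congr (if _ then _ else _); apply/idP/idP; rewrite !inE/= xsectionE.
Qed.

Lemma integral_ysection X l : measurable X -> (area R).-integrable X (EFin \o l) ->
  (forall y : R, \int[lebesgue_measure]_(x in ysection X y) (l (x, y))%:E = 0)%E ->
  \int[area R]_(p in X) l p = 0.
Proof.
move=> mX il l0; rewrite /Rintegral integral_mkcond.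
rewrite -(integral21_prod_meas1 (m1 := lebesgue_measure) (m2 := lebesgue_measure)); last first.
  exact/(integrable_mkcond _ mX).
rewrite integral0_eq// => y _; rewrite -[RHS](l0 y) [RHS]integral_mkcond.
apply: eq_integral => x _; rewrite /fubini_G /patch.
by congr (if _ then _ else _); apply/idP/idP; rewrite !inE/= ysectionE.
Qed.

Lemma integral_itv_id (a b : R) : a <= b ->
  (\int[@lebesgue_measure R]_(x in `[a, b]) x%:E = ((b ^+ 2 - a ^+ 2) / 2)%R%:E)%E.
Proof.
(* The fundamental theorem of calculus is applied with [a < b]; a one-point interval is treated
   apart. *)
rewrite le_eqVlt => /orP[/eqP->|ab].
  by rewrite set_itv1 integral_set1 subrr mul0r.
have dF (x : R) : is_derive x 1 (fun x : R => x ^+ 2 / 2) x.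
  by apply: is_derive_eq; rewrite /GRing.scale/=; field.
have cF : continuous (fun x : R => x ^+ 2 / 2).
  by move=> x; apply: cvgM; [exact: exprn_continuous|exact: cvg_cst].
rewrite mulrBl EFinB.
apply: (@continuous_FTC2 R id (fun x => x ^+ 2 / 2)) => //.
- by apply: continuous_subspaceT => x; exact: cvg_id.
- split.
  + by move=> x _.
  + exact/cvg_at_right_filter/cF.
  + exact/cvg_at_left_filter/cF.
- by move=> x _; rewrite derive1E; exact: derive_val.
Qed.

End Barycenters.

(** * The figure in standard position *)

Section StandardFigure.
Context {R : realType}.
Local Notation plane := (measurableTypeR R * measurableTypeR R)%type.

Definition std_segment (c r : R) : set (R * R) :=
  [set q | c <= q.1 /\ q.1 ^+ 2 + q.2 ^+ 2 <= r ^+ 2].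

(** Triangle [KOH] with [O] at the origin: its height [OG] and half its base both equal [a], so its
    two sides through [O] have slopes 1 and -1. *)
Definition std_triangle (a : R) : set (R * R) :=
  [set q | - a <= q.1 /\ `|q.2| <= - q.1].

Lemma measurable_le_set (l1 l2 : plane -> R) :
  measurable_fun setT l1 -> measurable_fun setT l2 ->
  measurable [set q | l1 q <= l2 q].
Proof.
move=> ml1 ml2; rewrite -[X in measurable X]setTI.
exact: (measurable_fun_ler ml1 ml2 measurableT (Y := [set true])).
Qed.

Lemma measurable_std_segment (c r : R) :
  measurable (std_segment c r : set plane).
Proof.
apply: measurableI; apply: measurable_le_set => //.
by apply: measurable_funD; apply: measurable_funX.
Qed.

Lemma measurable_std_triangle (a : R) : measurable (std_triangle a : set plane).
Proof.
apply: measurableI; apply: measurable_le_set => //.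
- exact: measurableT_comp.
- exact: measurable_funN.
Qed.

Lemma area_box (x1 x2 y1 y2 : R) : x1 < x2 -> y1 < y2 ->
  area R (`[x1, x2] `*` `[y1, y2]) = ((x2 - x1) * (y2 - y1))%:E.
Proof.
move=> x12 y12; transitivity
    (@lebesgue_measure R `[x1, x2] * @lebesgue_measure R `[y1, y2])%E.
  exact: product_measure1E.
by rewrite !lebesgue_measure_itv/= !lte_fin x12 y12 -!EFinB -EFinM.
Qed.

Lemma sqr_le_sqrt (x y : R) : 0 <= y -> (x ^+ 2 <= y) = (- Num.sqrt y <= x <= Num.sqrt y).
Proof. by move=> y0; rewrite -ler_norml -sqrtr_sqr ler_sqrt. Qed.

Lemma integral_sym_itv (w : R) :
  (\int[@lebesgue_measure R]_(x in `[(- w)%R, w]) x%:E = 0)%E.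
Proof.
have [w0|w0] := leP 0 w; last first.
  rewrite set_itv_ge ?integral_set0// -leNgt/=.
  by rewrite bnd_simp; lra.
rewrite integral_itv_id; last by lra.
by congr EFin; ring.
Qed.

Definition std_figure (a c r : R) : set (R * R) :=
  std_segment c r `|` std_triangle a.

Lemma measurable_std_figure (a c r : R) :
  measurable (std_figure a c r : set plane).
Proof.
by apply: measurableU; [exact: measurable_std_segment|exact: measurable_std_triangle].
Qed.

(** Confinement to a square gives both the finite area and the integrability of the coordinates. *)
Lemma std_figure_bounded (a c r : R) (q : R * R) :
  0 < a -> 0 < r -> c ^+ 2 + a ^+ 2 = r ^+ 2 ->
  std_figure a c r q -> `|q.1| <= r /\ `|q.2| <= r.
Proof.
move=> a0 r0 acr.
have sqr_le x : x ^+ 2 <= r ^+ 2 -> `|x| <= r.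
  by move=> xr; rewrite -ler_sqr ?nnegrE ?(ltW r0)// real_normK ?num_real.
have ar : a <= r by rewrite -(gtr0_norm a0) sqr_le// -acr lerDr sqr_ge0.
case=> -[/= h1 h2]; first by have := sqr_ge0 q.1; have := sqr_ge0 q.2; split; apply: sqr_le; lra.
have q2 := normr_ge0 q.2; split; last lra.
by rewrite ler_norml; lra.
Qed.

Lemma area_std_figure_fin (a c r : R) :
  0 < a -> 0 < r -> c ^+ 2 + a ^+ 2 = r ^+ 2 ->
  (area R (std_figure a c r) < +oo)%E.
Proof.
move=> a0 r0 acr.
apply: (@le_lt_trans _ _ (area R (`[- r, r] `*` `[- r, r]))); last first.
  have rr : - r < r by lra.
  by rewrite (area_box _ _ _ _ rr rr) ltry.
apply: le_measure; rewrite ?inE; try exact: measurable_std_figure.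
- by apply: measurableX; exact: measurable_itv.
- by move=> q /(std_figure_bounded _ _ _ _ a0 r0 acr); rewrite !ler_norml /= !in_itv.
Qed.

Lemma area_std_figure_gt0 (a c r : R) :
  0 < a -> (0 < area R (std_figure a c r))%E.
Proof.
move=> a0.
(* This box lies in the triangle, since there [|y| <= a / 2 <= - x]. *)
apply: (@lt_le_trans _ _ (area R (`[- a, - a / 2] `*` `[- a / 2, a / 2]))).
  have aa1 : - a < - a / 2 by lra.
  have aa2 : - a / 2 < a / 2 by lra.
  rewrite (area_box _ _ _ _ aa1 aa2) lte_fin.
  by rewrite mulr_gt0// subr_gt0.
apply: le_measure; rewrite ?inE; try exact: measurable_std_figure.
- by apply: measurableX; exact: measurable_itv.
- move=> q /=; rewrite !in_itv/= => -[h1 h2]; right; split => /=; first lra.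
  by rewrite ler_norml; lra.
Qed.

Lemma integrable_std_figure (a c r : R) (l : plane -> R) :
  0 < a -> 0 < r -> c ^+ 2 + a ^+ 2 = r ^+ 2 -> measurable_fun setT l ->
  (forall q, std_figure a c r q -> `|l q| <= r) ->
  (area R).-integrable (std_figure a c r) (EFin \o l).
Proof.
move=> a0 r0 acr ml lr; apply: measurable_bounded_integrable.
- exact: measurable_std_figure.
- exact: area_std_figure_fin.
- exact: measurable_funTS.
- exists r; split; first exact: num_real.
  by move=> M /ltW rM q /lr /le_trans; apply.
Qed.

(** As [c > 0], a vertical line meets at most one of the two pieces, and each piece is symmetric
    about the first axis. *)
Lemma xsection_std_figure (a c r x : R) : 0 < c ->
  exists w, xsection (std_figure a c r) x = `[- w, w]%classic.
Proof.
move=> c0.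
(* The choice [w = -1] encodes an empty section. *)
have none : `[- (-1 : R), -1]%classic = set0.
  by apply: set_itv_ge; rewrite -leNgt bnd_simp; lra.
have [cx|xc] := leP c x.
  have [xr|rx] := leP (x ^+ 2) (r ^+ 2).
    exists (Num.sqrt (r ^+ 2 - x ^+ 2)); apply/seteqP; split => y /=.
      rewrite xsectionE in_itv/= -sqr_le_sqrt ?subr_ge0// => -[[/=]|[/=]]; first by lra.
      by rewrite ler_norml; lra.
    rewrite xsectionE in_itv/= -sqr_le_sqrt ?subr_ge0// => h; left; split => //=; lra.
  exists (-1); rewrite none; apply/seteqP; split => y //=.
  rewrite xsectionE => -[[/=]|[/=]]; first by nra.
  by rewrite ler_norml; lra.
have [ax|xa] := leP (- a) x.
  exists (- x); apply/seteqP; split => y /=; rewrite xsectionE in_itv/=.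
    by move=> -[[/=]|[/=]]; [lra|rewrite ler_norml].
  by move=> h; right; split => //=; rewrite ler_norml.
exists (-1); rewrite none; apply/seteqP; split => y //=.
by rewrite xsectionE => -[[/=]|[/=]]; lra.
Qed.

Lemma ysection_std_figure (a c r y : R) :
  0 < c -> c ^+ 2 + a ^+ 2 = r ^+ 2 -> `|y| <= a ->
  ysection (std_figure a c r) y = `[- a, - `|y|] `|` `[c, Num.sqrt (r ^+ 2 - y ^+ 2)].
Proof.
move=> c0 acr; rewrite ler_norml => ya.
have ry : 0 <= r ^+ 2 - y ^+ 2 by nra.
apply/seteqP; split => x /=; rewrite ysectionE !in_itv/=.
  move=> -[[/= h1 h2]|[/= h1 h2]]; [right|left].
    rewrite h1/=.
    suff : - Num.sqrt (r ^+ 2 - y ^+ 2) <= x <= Num.sqrt (r ^+ 2 - y ^+ 2) by case/andP.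
    by rewrite -sqr_le_sqrt//; lra.
  by rewrite h1/=; lra.
move=> -[/andP[h1 h2]|/andP[h1 h2]]; [right|left]; split => //=; first by lra.
have := sqr_le_sqrt x _ ry; rewrite h2 => h; suff : x ^+ 2 <= r ^+ 2 - y ^+ 2 by lra.
by rewrite h andbT; have := sqrtr_ge0 (r ^+ 2 - y ^+ 2); lra.
Qed.

(** The triangle has [|y| <= - x <= a], and in the segment [x >= c > 0] forces
    [y ^+ 2 <= r ^+ 2 - c ^+ 2 = a ^+ 2]. *)
Lemma ysection_std_figure0 (a c r y : R) :
  0 < a -> 0 < c -> c ^+ 2 + a ^+ 2 = r ^+ 2 -> a < `|y| ->
  ysection (std_figure a c r) y = set0.
Proof.
move=> a0 c0 acr ya; apply/seteqP; split => x //=; rewrite ysectionE => -[[/= h1 h2]|[/= h1 h2]].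
  by have : a ^+ 2 < `|y| ^+ 2; [nra|rewrite real_normK ?num_real//; nra].
lra.
Qed.

Lemma is_barycenter_std_figure (a c r : R) :
  0 < a -> 0 < c -> 0 < r -> c ^+ 2 + a ^+ 2 = r ^+ 2 ->
  is_barycenter (std_figure a c r) 0.
Proof.
move=> a0 c0 r0 acr.
pose F : set plane := std_figure a c r.
have mF : measurable F by exact: measurable_std_figure.
have F_bounded q (Fq : F q) := std_figure_bounded a c r q a0 r0 acr Fq.
have mfst : measurable_fun setT (fun q : plane => q.1 : R) by exact: measurable_fst.
have msnd : measurable_fun setT (fun q : plane => q.2 : R) by exact: measurable_snd.
have i1 := integrable_std_figure a c r _ a0 r0 acr mfst (fun q Fq => proj1 (F_bounded _ Fq)).
have i2 := integrable_std_figure a c r _ a0 r0 acr msnd (fun q Fq => proj2 (F_bounded _ Fq)).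
split => //.
  by rewrite area_std_figure_gt0//= area_std_figure_fin.
have -> : \int[area R]_(q in F) q.1 = 0.
  apply: (integral_ysection F (fun q => q.1)) => // y /=.
  have [ya|ya] := leP `|y| a; last by rewrite ysection_std_figure0// integral_set0.
  have ry : a ^+ 2 = r ^+ 2 - c ^+ 2 by lra.
  have y2 : y ^+ 2 <= a ^+ 2 by rewrite -(real_normK (num_real y)) ler_sqr ?nnegrE ?(ltW a0).
  have ry0 : 0 <= r ^+ 2 - y ^+ 2 by have := sqr_ge0 c; lra.
  have /andP[_ cs] : - Num.sqrt (r ^+ 2 - y ^+ 2) <= c <= Num.sqrt (r ^+ 2 - y ^+ 2).
    by rewrite -sqr_le_sqrt//; lra.
  rewrite ysection_std_figure// integral_setU//; last first.
    apply/disj_setPS => x [/=]; rewrite !in_itv/=.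
    by have := normr_ge0 y; lra.
  have ay : - a <= - `|y| by rewrite lerN2.
  rewrite (integral_itv_id _ _ ay) (integral_itv_id _ _ cs).
  rewrite -EFinD sqr_sqrtr ?sqrrN ?real_normK ?num_real//.
  by congr EFin; lra.
have -> : \int[area R]_(q in F) q.2 = 0.
  apply: (integral_xsection F (fun q => q.2)) => // x /=.
  by have [w ->] := xsection_std_figure a c r x c0; exact: integral_sym_itv.
by rewrite !mul0r.
Qed.

End StandardFigure.

(** * The region enclosed by the boundary of a convex set *)

Section EnclosedRegions.
Context {R : realType}.
Implicit Types (p q z : R * R) (K U : set (R * R)).

(** Since [C] avoids [K] minus [U], its traces on [U] and on [K] coincide: a nonempty set both open
    and closed in [C], hence all of [C]. *)
Lemma connected_sub_open_closed (T : topologicalType) (C K U : set T) :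
  open U -> closed K -> U `<=` K -> C `<=` ~` (K `\` U) -> connected C ->
  C `&` U !=set0 -> C `<=` K.
Proof.
move=> oU cK UK CE connC CU.
have CUK : C `&` U = C `&` K.
  apply/seteqP; split => x [Cx]; first by move=> /UK.
  by move=> Kx; split => //; apply: contrapT => nUx; exact: (CE _ Cx).
have <- : C `&` U = C by apply: connC => //; [exists U|exists K].
by move=> x [_ /UK].
Qed.

(** The component of a point of [U] cannot leave the bounded set [K]; that of a point outside [K]
    contains a ray, so it is unbounded. *)
Lemma enclosed_convex_boundary K U :
  closed K -> open U -> U `<=` K -> bounded_set K -> K !=set0 ->
  (forall p q, K p -> K q -> segment p q `<=` K) ->
  enclosed (K `\` U) = K.
Proof.
move=> cK oU UK bK [q Kq] convK; apply/seteqP; split => p; last first.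
  move=> Kp; rewrite /enclosed /=.
  have [Up|nUp] := pselect (U p); last first.
    (* A point on the curve itself has an empty component, which is bounded. *)
    rewrite connected_component_out ?setC_K; last by move=> /=; apply.
    by exists 0; split=> // M _ x.
  have CK : connected_component (~` (K `\` U)) p `<=` K.
    apply: (@connected_sub_open_closed _ _ K U) => //.
    - exact: connected_component_sub.
    - exact: component_connected.
    - exists p; split => //; apply: connected_component_refl.
      by move=> [_ /(_ Up)].
  case: bK => M [Mr KM]; exists M; split => // M' MM' x /CK; exact: KM.
rewrite /enclosed /= => bC; apply: contrapT => nKp.
have pq : p - q != 0.
  by rewrite subr_eq0; apply: contra_not_neq nKp => ->.
(* By convexity the ray leaving [p] away from [q] misses [K], so it stays in
   the component of [p]. *)
pose ray (u : R) : R * R := p + u *: (p - q).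
have ray_cont : continuous ray.
  by move=> u; apply: cvgD; [exact: cvg_cst|apply: cvgZr_tmp; exact: cvg_id].
have rayC : ray @` `[0, +oo[ `<=` connected_component (~` (K `\` U)) p.
  apply: connected_component_max.
  - exists 0; first by rewrite /= in_itv/= lexx.
    by rewrite /ray scale0r addr0.
  - move=> _ [u + <-] -[Kz _]; rewrite /= in_itv/= andbT => u0; apply: nKp.
    have u1 : 1 + u != 0 by rewrite gt_eqF//; lra.
    (* Solving [z = p + u *: (p - q)] for [p] puts [p] on the segment from [z] to [q] with this
       parameter. *)
    apply: (convK _ _ Kz Kq); exists (u / (1 + u)).
      by rewrite divr_ge0 ?ler_pdivrMr/=; lra.
    by rewrite [LHS]surjective_pairing; congr pair; rewrite /= /GRing.scale/=; field.
  - apply: connected_continuous_connected; last exact: continuous_subspaceT.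
    by apply/connected_intervalP; exact: interval_is_interval.
case: bC => M [Mr CM].
have npq : 0 < `|p - q| by rewrite normr_gt0.
(* Chosen so that the ray at parameter [u + 1] has norm at least [|M| + 1 + |p - q|], beyond the
   bound [|M| + 1] on the component. *)
pose u := (`|M| + 1 + `|p|) / `|p - q|.
have u0 : 0 <= u by rewrite divr_ge0 ?(ltW npq)// !addr_ge0.
have MM : M < `|M| + 1 by rewrite ltr_pwDr ?ler_norm.
have rayu : ray u = p + u *: (p - q) by [].
have /(CM _ MM) : connected_component (~` (K `\` U)) p (ray u + (p - q)).
  apply: rayC; exists (u + 1); first by rewrite /= in_itv/= addr_ge0.
  by rewrite /ray scalerDl scale1r addrA.
rewrite rayu.
have : `|(u + 1) *: (p - q)| <= `|p + u *: (p - q) + (p - q)| + `|p|.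
  rewrite -[leRHS](addrC) -[X in _ <= X + _]normrN.
  apply: le_trans (ler_normD _ _).
  by rewrite scalerDl scale1r -addrA addKr.
rewrite normrZ ger0_norm ?addr_ge0// mulrDl mul1r divfK ?gt_eqF//.
by move=> /= h1 h2; lra.
Qed.

End EnclosedRegions.

(** * Rotated coordinates *)

Section MovingFrame.
Context {R : realType}.
Implicit Types (O p q : R * R) (r m c a : R).

(** Coordinates of [p - O] in the orthonormal basis [(cos m, sin m)], [(- sin m, cos m)]. *)
Definition frame O m p : R * R :=
  ((p.1 - O.1) * cos m + (p.2 - O.2) * sin m,
   (p.2 - O.2) * cos m - (p.1 - O.1) * sin m).

(** The inverse rotation and translation, in the shape required by [is_barycenter_preimage]. *)
Lemma frameK O m p :
  p = (O.1 + (cos m * (frame O m p).1 + - sin m * (frame O m p).2),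
       O.2 + (sin m * (frame O m p).1 + cos m * (frame O m p).2)).
Proof.
have cs := cos2Dsin2 m.
rewrite [LHS]surjective_pairing; congr pair; rewrite /frame/=.
- transitivity (O.1 + (p.1 - O.1) * (cos m ^+ 2 + sin m ^+ 2)); last by ring.
  by rewrite cs; ring.
- transitivity (O.2 + (p.2 - O.2) * (cos m ^+ 2 + sin m ^+ 2)); last by ring.
  by rewrite cs; ring.
Qed.

Lemma frame_inj O m : injective (frame O m).
Proof. by move=> p q pq; rewrite (frameK O m p) (frameK O m q) pq. Qed.

Lemma frame_affine O m p q (k : R) :
  frame O m ((1 - k) *: p + k *: q) =
  (1 - k) *: frame O m p + k *: frame O m q.
Proof. by congr pair; rewrite /frame/= /GRing.scale/=; ring. Qed.

Lemma frame_circle_point O m r (u : R) :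
  frame O m (circle_point O r u) = (r * cos (u - m), r * sin (u - m)).
Proof. by rewrite /frame /circle_point cosB sinB; congr pair => /=; ring. Qed.

Lemma sqr_dist p q : dist p q ^+ 2 = (p.1 - q.1) ^+ 2 + (p.2 - q.2) ^+ 2.
Proof. by rewrite sqr_sqrtr// addr_ge0 ?sqr_ge0. Qed.

Lemma dist_frame O m p q : dist (frame O m p) (frame O m q) = dist p q.
Proof.
rewrite /dist; congr Num.sqrt.
transitivity (((p.1 - q.1) ^+ 2 + (p.2 - q.2) ^+ 2) * (cos m ^+ 2 + sin m ^+ 2)).
  by rewrite /frame/=; ring.
by rewrite cos2Dsin2 mulr1.
Qed.

Lemma frame_segment O m p q :
  segment p q = frame O m @^-1` segment (frame O m p) (frame O m q).
Proof.
apply/seteqP; split => x [k k01].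
  by move=> ->; exists k => //; rewrite frame_affine.
by rewrite -frame_affine => /frame_inj ->; exists k.
Qed.

Lemma frame_triangle O m p q z :
  triangle p q z =
  frame O m @^-1` triangle (frame O m p) (frame O m q) (frame O m z).
Proof.
have frameE (a b c : R) : a + b + c = 1 ->
    frame O m (a *: p + b *: q + c *: z) =
    a *: frame O m p + b *: frame O m q + c *: frame O m z.
  move=> abc; have -> : a = 1 - b - c by lra.
  by congr pair; rewrite /frame/= /GRing.scale/=; ring.
apply/seteqP; split => x [a [b [c [a0 b0 c0 abc]]]].
  by move=> ->; exists a, b, c; split => //; rewrite frameE.
by rewrite -frameE// => /frame_inj ->; exists a, b, c.
Qed.

Lemma area_preserving_frame O m : area_preserving (frame O m).
Proof.
have det : cos m * cos m - sin m * (- sin m) = 1 :> R.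
  by rewrite -(cos2Dsin2 m); ring.
have := area_preserving_comp _ _ (area_preserving_translation (- O.1) (- O.2))
  (area_preserving_linear _ _ _ _ det).
by congr area_preserving; apply/funext => p; congr pair; rewrite /frame/=; ring.
Qed.

Lemma continuous_frame1 O m : continuous (fun p : R * R => (frame O m p).1).
Proof.
move=> p; apply: cvgD; (apply: cvgM; last exact: cvg_cst);
  (apply: cvgB; last exact: cvg_cst).
- exact: (@cvg_fst _ _ (nbhs p.1) (nbhs p.2)).
- exact: (@cvg_snd _ _ (nbhs p.1) (nbhs p.2)).
Qed.

Lemma continuous_frame2 O m : continuous (fun p : R * R => (frame O m p).2).
Proof.
move=> p; apply: cvgB; (apply: cvgM; last exact: cvg_cst);
  (apply: cvgB; last exact: cvg_cst).
- exact: (@cvg_snd _ _ (nbhs p.1) (nbhs p.2)).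
- exact: (@cvg_fst _ _ (nbhs p.1) (nbhs p.2)).
Qed.

End MovingFrame.

(** * Arcs, circular segments and triangles in rotated coordinates *)

Section Segments.
Context {R : realType}.
Implicit Types (O p q : R * R) (r m c a : R).

Lemma frame_sqr O m p :
  (frame O m p).1 ^+ 2 + (frame O m p).2 ^+ 2 = (p.1 - O.1) ^+ 2 + (p.2 - O.2) ^+ 2.
Proof.
rewrite -[RHS]mulr1 -(cos2Dsin2 m) /frame/=; ring.
Qed.

Lemma continuous_frame_sqr O m :
  continuous (fun p => (frame O m p).1 ^+ 2 + (frame O m p).2 ^+ 2).
Proof.
move=> p; apply: cvgD.
  by apply: (@cvg_comp _ _ _ _ (fun x : R => x ^+ 2) _ (nbhs (frame O m p).1));
    [exact: continuous_frame1|exact: exprn_continuous].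
by apply: (@cvg_comp _ _ _ _ (fun x : R => x ^+ 2) _ (nbhs (frame O m p).2));
    [exact: continuous_frame2|exact: exprn_continuous].
Qed.

(** A disc cut by a half-plane is convex; the open set is given by the strict inequalities. *)
Lemma enclosed_segment_boundary O m c r : 0 <= r -> c <= r ->
  enclosed (frame O m @^-1` (std_segment c r `\`
    [set q | c < q.1 /\ q.1 ^+ 2 + q.2 ^+ 2 < r ^+ 2])) =
  frame O m @^-1` std_segment c r.
Proof.
move=> r0 cr; set K := frame O m @^-1` std_segment c r.
pose U := frame O m @^-1` [set q | c < q.1 /\ q.1 ^+ 2 + q.2 ^+ 2 < r ^+ 2].
have c1 := continuous_frame1 O m.
have c2 := continuous_frame_sqr O m.
apply: (enclosed_convex_boundary K U).
- apply: (@closedI _ ((fun p => (frame O m p).1) @^-1` [set x | c <= x])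
    ((fun p => (frame O m p).1 ^+ 2 + (frame O m p).2 ^+ 2) @^-1` [set x | x <= r ^+ 2])).
    by apply: closed_comp => [p _|]; [exact: c1|exact: closed_ge].
  by apply: closed_comp => [p _|]; [exact: c2|exact: closed_le].
- apply: (@openI _ ((fun p => (frame O m p).1) @^-1` [set x | c < x])
    ((fun p => (frame O m p).1 ^+ 2 + (frame O m p).2 ^+ 2) @^-1` [set x | x < r ^+ 2])).
    by apply: open_comp => [p _|]; [exact: c1|exact: open_gt].
  by apply: open_comp => [p _|]; [exact: c2|exact: open_lt].
- by move=> p [h1 h2]; split; exact: ltW.
- exists (`|O.1| + `|O.2| + r); split; first exact: num_real.
  move=> M /ltW OM p [_]; rewrite frame_sqr => h.
  have coord (x y z : R) : (x - y) ^+ 2 + z ^+ 2 <= r ^+ 2 -> `|x| <= `|y| + r.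
    move=> xy; have : `|x - y| <= r.
      rewrite -ler_sqr ?nnegrE// real_normK ?num_real//.
      by have := sqr_ge0 z; lra.
    by have := ler_normD (x - y) y; rewrite subrK; lra.
  have h1 := coord _ _ _ h.
  rewrite addrC in h; have h2 := coord _ _ _ h.
  rewrite /= prod_normE ge_max; have := normr_ge0 O.1; have := normr_ge0 O.2.
  by move=> *; apply/andP; split; lra.
(* The vertex of the arc, with frame coordinates [(r, 0)]. *)
- exists (circle_point O r m); rewrite /K /= frame_circle_point subrr cos0 sin0.
  by split => /=; lra.
- move=> p q [p1 p2] [q1 q2] x [k /andP[k0 k1] ->].
  rewrite /K /= frame_affine; move: p1 p2 q1 q2.
  case: (frame O m p) (frame O m q) => x1 x2 [y1 y2] /= p1 p2 q1 q2.
  split; rewrite /= /GRing.scale/=.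
    have : 0 <= (1 - k) * (x1 - c) by rewrite mulr_ge0; lra.
    have : 0 <= k * (y1 - c) by rewrite mulr_ge0; lra.
    lra.
  (* Convexity of the squared norm, with its defect [k (1 - k)] times the squared distance made
     explicit. *)
  have -> : ((1 - k) * x1 + k * y1) ^+ 2 + ((1 - k) * x2 + k * y2) ^+ 2 =
    (1 - k) * (x1 ^+ 2 + x2 ^+ 2) + k * (y1 ^+ 2 + y2 ^+ 2) -
    (k * (1 - k)) * ((x1 - y1) ^+ 2 + (x2 - y2) ^+ 2) by ring.
  have : 0 <= (k * (1 - k)) * ((x1 - y1) ^+ 2 + (x2 - y2) ^+ 2).
    by apply: mulr_ge0; [rewrite mulr_ge0//; lra|rewrite addr_ge0 ?sqr_ge0].
  have : 0 <= (1 - k) * (r ^+ 2 - (x1 ^+ 2 + x2 ^+ 2)) by rewrite mulr_ge0; lra.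
  have : 0 <= k * (r ^+ 2 - (y1 ^+ 2 + y2 ^+ 2)) by rewrite mulr_ge0; lra.
  lra.
Qed.

(** The description uses [b ^+ 2] because the sign of [b] depends on the direction in which the arc
    is swept. *)
Lemma segment_vertical (c b : R) : b != 0 ->
  segment (c, - b) (c, b) = [set q | q.1 = c /\ q.2 ^+ 2 <= b ^+ 2].
Proof.
move=> b0; apply/seteqP; split => -[x y].
  move=> [k /andP[k0 k1] [-> ->]] /=; split; rewrite /GRing.scale/=; first by ring.
  have -> : (1 - k) * - b + k * b = (2 * k - 1) * b by ring.
  rewrite exprMn ger_pMl ?exprn_even_gt0//; nra.
(* The parameter [k] solves [(2 * k - 1) * b = y]. *)
move=> /= [-> yb]; exists ((y / b + 1) / 2).
  have : `|y / b| <= 1.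
    rewrite -ler_sqr ?nnegrE// real_normK ?num_real// expr_div_n expr1n.
    by rewrite ler_pdivrMr ?exprn_even_gt0// mul1r.
  by rewrite ler_norml => yb1; lra.
by congr pair; rewrite /= /GRing.scale/=; field.
Qed.

(** Cosine is even and strictly decreasing on [[0, pi]]. *)
Lemma ler_cos_norm (x y : R) : `|x| <= pi -> `|y| <= pi ->
  (cos x <= cos y) = (`|y| <= `|x|).
Proof.
move=> xpi ypi; rewrite -(cos_norm x) -(cos_norm y); apply/idP/idP.
  by apply: contraLR; rewrite -!ltNge => ?; rewrite ltr_cos// in_itv/= normr_ge0.
rewrite le_eqVlt => /orP[/eqP->//|?].
by apply/ltW; rewrite ltr_cos// in_itv/= normr_ge0.
Qed.

Lemma polar_sqr r (u : R) : (r * cos u) ^+ 2 + (r * sin u) ^+ 2 = r ^+ 2.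
Proof. by rewrite -[RHS]mulr1 -(cos2Dsin2 u); ring. Qed.

(** The arc consists of the angles within [|d|] of the middle angle [m], where [d = (t - s) / 2];
    monotonicity of cosine turns this into a half-plane condition. *)
Lemma circle_arc_frame O r (s t : R) : 0 < r -> `|(t - s) / 2| <= pi ->
  circle_arc O r s t = frame O ((s + t) / 2) @^-1`
    [set q | r * cos ((t - s) / 2) <= q.1 /\ q.1 ^+ 2 + q.2 ^+ 2 = r ^+ 2].
Proof.
move=> r0; set m := (s + t) / 2; set d := (t - s) / 2 => dpi.
have inE u : (Num.min s t <= u <= Num.max s t) = (`|u - m| <= `|d|).
  rewrite /m /d ge_min le_max.
  have [st|st] := leP s t.
    rewrite [`|(t - s) / 2|]ger0_norm; last by lra.
    by rewrite ler_norml; apply/idP/idP; lra.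
  rewrite [`|(t - s) / 2|]ltr0_norm; last by lra.
  by rewrite ler_norml; apply/idP/idP; lra.
apply/seteqP; split => p.
  move=> [u us <-]; have ud : `|u - m| <= `|d| by rewrite -inE.
  rewrite /preimage /mkset frame_circle_point/=; split.
    by rewrite ler_pM2l// ler_cos_norm// (le_trans ud).
  exact: polar_sqr.
case; set q := frame O m p => h1 h2.
have arc u : `|u| <= `|d| -> r * cos u = q.1 -> r * sin u = q.2 ->
    circle_arc O r s t p.
  move=> ud e1 e2; exists (m + u); first by rewrite /= inE addrC addKr.
  apply: (@frame_inj _ O m); rewrite frame_circle_point addrC addKr e1 e2.
  by rewrite -surjective_pairing.
pose x := q.1 / r.
have xr : r * x = q.1 by rewrite /x; field; rewrite gt_eqF.
have x1 : x ^+ 2 <= 1 by rewrite /x expr_div_n ler_pdivrMr ?exprn_gt0// mul1r; have := sqr_ge0 q.2; lra.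
have x1' : -1 <= x <= 1 by rewrite -ler_norml -ler_sqr ?nnegrE// real_normK ?num_real// expr1n.
have cosx : cos (acos x) = x by rewrite acosK// in_itv.
have ax : `|acos x| <= `|d|.
  rewrite -ler_cos_norm ?cosx// ?ger0_norm ?acos_ge0 ?acos_lepi//.
  by rewrite -(ler_pM2l r0) xr.
have sinx : (r * sin (acos x)) ^+ 2 = q.2 ^+ 2.
  by have := polar_sqr r (acos x); rewrite cosx xr; lra.
(* The angle of [q] is [acos x] or its opposite, according to the sign of [q.2]. *)
move/eqP: sinx; rewrite eqf_sqr => /orP[/eqP e|/eqP e].
  by apply: (arc (acos x)); rewrite ?cosx.
apply: (arc (- acos x)); rewrite ?normrN ?cosN ?sinN ?cosx//.
by rewrite mulrN e opprK.
Qed.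

(** Arc and chord are the points of [std_segment] where one of its two inequalities is an equality,
    that is, its boundary. *)
Lemma circular_segment_frame O r (s t : R) :
  0 < r -> s != t -> `|(t - s) / 2| < pi ->
  circular_segment O r s t =
  frame O ((s + t) / 2) @^-1` std_segment (r * cos ((t - s) / 2)) r.
Proof.
move=> r0 st dpi; rewrite -enclosed_segment_boundary ?(ltW r0)//; last first.
  by rewrite ger_pMr// cos_le1.
congr enclosed; rewrite circle_arc_frame ?(ltW dpi)//.
set m := (s + t) / 2; set d := (t - s) / 2.
have sE : s - m = - d by rewrite /m /d; field.
have tE : t - m = d by rewrite /m /d; field.
have sind : r * sin d != 0.
  rewrite mulf_neq0 ?(gt_eqF r0)//.
  have d0 : d != 0 by apply: contra_neq st; rewrite /d; lra.
  have : 0 < sin `|d| by rewrite sin_gt0_pi// normr_gt0 d0.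
  by have [_|_] := ger0P d; rewrite ?sinN ?oppr_gt0; [move/gt_eqF->|move/lt_eqF->].
rewrite (frame_segment O m) !frame_circle_point sE tE cosN sinN mulrN.
rewrite segment_vertical// -preimage_setU; congr (_ @^-1` _).
have dr := polar_sqr r d.
apply/seteqP; split => q /=.
  move=> [[h1 h2]|[h1 h2]].
    by split; [split => //; rewrite h2|rewrite h2 ltxx => -[]].
  by split; [split; rewrite h1; lra|rewrite h1 ltxx => -[]].
move=> [[h1 h2] h3].
have [h4|h4] := leP q.1 (r * cos d).
  have h5 : q.1 = r * cos d by lra.
  by right; split => //; rewrite h5 in h2; lra.
left; split => //; apply/eqP; rewrite eq_le h2 leNgt; apply/negP => h5.
exact: h3.
Qed.

Lemma triangle_std (a b : R) : 0 < a -> b ^+ 2 = a ^+ 2 ->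
  triangle (- a, b) 0 (- a, - b) = std_triangle a.
Proof.
move=> a0 ba; have b0 : b != 0 by rewrite -sqrf_eq0 ba sqrf_eq0 gt_eqF.
have normb : `|b| = a by rewrite -(gtr0_norm a0) -!sqrtr_sqr ba.
apply/seteqP; split => -[x y].
  move=> [u [v [w [u0 v0 w0 uvw [-> ->]]]]]; split; rewrite /= /GRing.scale/=; first nra.
  have -> : u * b + v * 0 + w * - b = (u - w) * b by ring.
  rewrite normrM normb.
  have : `|u - w| <= u + w by rewrite ler_norml; lra.
  nra.
move=> [/= h1 h2].
have : `|y / b| <= - x / a by rewrite normrM normfV normb ler_pM2r ?invr_gt0.
rewrite ler_norml => h3.
have h4 : - x / a <= 1 by rewrite ler_pdivrMr// mul1r; lra.
(* Barycentric coordinates: the base vertices share the weight [- x / a], with difference [y / b];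
   the origin takes the rest. *)
exists ((- x / a + y / b) / 2), (1 + x / a), ((- x / a - y / b) / 2).
split; [lra|lra|lra|lra|].
by congr pair; rewrite /= /GRing.scale/=; field; rewrite ?b0 ?gt_eqF.
Qed.

End Segments.

(** * Midpoints, parallels and antipodes in rotated coordinates *)

Section FrameOfTheFigure.
Context {R : realType}.
Implicit Types (O p q u v : R * R) (r m : R).

Lemma frame_origin O m : frame O m O = 0.
Proof. by rewrite /frame !subrr !mul0r subr0 addr0. Qed.

Lemma frame_midpoint O m p q :
  frame O m (midpoint p q) = midpoint (frame O m p) (frame O m q).
Proof. by congr pair; rewrite /frame/= /GRing.scale/=; field. Qed.

(** The cross product of two directions is invariant under rotation. *)
Lemma parallel_frame O m p q u v : parallel p q u v ->
  parallel (frame O m p) (frame O m q) (frame O m u) (frame O m v).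
Proof.
rewrite /parallel => /eqP; rewrite -subr_eq0 => /eqP pq; apply/eqP.
rewrite -subr_eq0; apply/eqP.
transitivity (((q.1 - p.1) * (v.2 - u.2) - (q.2 - p.2) * (v.1 - u.1)) *
  (cos m ^+ 2 + sin m ^+ 2)); last by rewrite pq mul0r.
by rewrite /frame/=; ring.
Qed.

(** The origin lies on the segment from [(r, 0)] to the image [(x, y)] of [p], so [y = 0]; then [x]
    is [r] or [- r], and [x = r] would keep the whole segment at [(r, 0)]. *)
Lemma frame_antipode O m r p : 0 < r ->
  is_diameter O r (circle_point O r m) p -> frame O m p = (- r, 0).
Proof.
move=> r0 [_ cp [k _ /(congr1 (frame O m))]].
have : (frame O m p).1 ^+ 2 + (frame O m p).2 ^+ 2 = r ^+ 2.
  rewrite frame_sqr; move: cp; rewrite /circle /= => <-; rewrite sqr_dist; ring.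
rewrite frame_affine frame_origin frame_circle_point subrr cos0 sin0.
case: (frame O m p) => x y /= xyr [e1 e2].
rewrite /GRing.scale/= in e1 e2.
have k0 : k != 0.
  by apply/eqP => k0; move: e1; rewrite k0; nra.
have y0 : y = 0.
  by apply: (mulfI k0); lra.
rewrite y0 in xyr *; congr pair.
have /eqP : x ^+ 2 = r ^+ 2 by rewrite -xyr; ring.
rewrite eqf_sqr => /orP[/eqP xr|/eqP//].
by move: e1; rewrite xr; nra.
Qed.

End FrameOfTheFigure.

Theorem proposition3p3 (R : realType) (O A B C D P G K H : R * R) (r s t : R)
  (r_gt0 : 0 < r)
  (A_def : A = circle_point O r s)
  (C_def : C = circle_point O r t)
  (B_def : B = arc_midpoint O r s t)
  (arc_nondegenerate : s <> t)
  (lt_semicircle : arc_length r s t < semicircle_length r)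
  (D_def : D = midpoint A C)
  (BP_diameter : is_diameter O r B P)
  (G_between : segment O P G)
  (OG_def : dist O G ^+ 2 = dist B D * dist P D)
  (KH_parallel : parallel K H A C)
  (KH_AC : dist K H = dist A C)
  (G_mid : G = midpoint K H) :
  is_barycenter (circular_segment O r s t `|` triangle K O H) O.
Proof.
set m := (s + t) / 2; set d := (t - s) / 2.
pose f := frame O m.
have neq_st : s != t by exact/eqP.
(* Being less than a semicircle is what makes [c = r * cos d] positive. *)
have lt_d : `|d| < pi / 2.
  move: lt_semicircle; rewrite /arc_length /semicircle_length mulrC ltr_pM2r//.
  by rewrite /d normrM [`|2^-1|]ger0_norm; lra.
have d_neq0 : d != 0 by apply: contra_neq neq_st; rewrite /d; lra.
have pi0 := @pi_gt0 R.
(* [a] is the positive half-chord; [b] carries the sign of the sweep, so only [b ^+ 2 = a ^+ 2] is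
   common to both directions. *)
pose c := r * cos d; pose a := r * sin `|d|; pose b := r * sin d.
have c0 : 0 < c.
  by rewrite mulr_gt0// cos_gt0_pihalf// -ltr_norml.
have a0 : 0 < a.
  by rewrite mulr_gt0// sin_gt0_pi// normr_gt0 d_neq0/=; lra.
have ba : b ^+ 2 = a ^+ 2.
  by rewrite /a /b; have [//|_] := ger0P d; rewrite sinN mulrN sqrrN.
have car : c ^+ 2 + a ^+ 2 = r ^+ 2 by rewrite -ba; exact: polar_sqr.
have fA : f A = (c, - b).
  have sE : s - m = - d by rewrite /m /d; field.
  by rewrite A_def /f frame_circle_point sE cosN sinN mulrN.
have fC : f C = (c, b).
  have tE : t - m = d by rewrite /m /d; field.
  by rewrite C_def /f frame_circle_point tE.
have fB : f B = (r, 0).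
  by rewrite B_def /f frame_circle_point subrr cos0 sin0 mulr1 mulr0.
have fD : f D = (c, 0).
  rewrite D_def /f frame_midpoint -/f fA fC.
  by congr pair; rewrite /= /GRing.scale/=; field.
have fP : f P = (- r, 0).
  by apply: frame_antipode => //; rewrite -/(arc_midpoint O r s t) -B_def.
have cr : c <= r by rewrite ger_pMr// cos_le1.
have fG : f G = (- a, 0).
  have [k /andP[k0 k1] GE] := G_between.
  have fGE : f G = (- (k * r), 0).
    rewrite GE /f frame_affine frame_origin -/f fP.
    by congr pair; rewrite /= /GRing.scale/=; ring.
  suff -> : a = k * r by [].
  (* Both sides are nonnegative, so it suffices to compare squares:
     [OG ^ 2 = (r - c) (r + c) = a ^ 2]. *)
  apply/eqP; rewrite -(@eqrXn2 _ 2) ?(ltW a0)// ?mulr_ge0 ?(ltW r_gt0)//; apply/eqP.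
  have distBD : dist B D = r - c.
    rewrite -(dist_frame O m) -/f fB fD /dist/= subr0 expr0n addr0.
    by rewrite sqrtr_sqr ger0_norm// subr_ge0.
  have distPD : dist P D = r + c.
    rewrite -(dist_frame O m) -/f fP fD /dist/= subr0 expr0n addr0.
    by rewrite sqrtr_sqr ltr0_norm; lra.
  have := OG_def; rewrite -(dist_frame O m) sqr_dist -/f fGE distBD distPD.
  by rewrite /f frame_origin/=; lra.
(* [AC] is vertical in the frame, so [K] and [H] share their first coordinate; the midpoint [G]
   makes it [- a] and the second coordinates opposite. The length fixes [b'] up to sign. *)
have [b' b'a fKH] : exists2 b', b' ^+ 2 = a ^+ 2 & f K = (- a, b') /\ f H = (- a, - b').
  have := parallel_frame O m _ _ _ _ KH_parallel.
  have := congr1 (fun x => x ^+ 2) KH_AC.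
  rewrite /= -(dist_frame O m K H) -(dist_frame O m A C) !sqr_dist -/f fA fC.
  move: (congr1 f G_mid); rewrite fG /f frame_midpoint -/f.
  case: (f K) (f H) => k1 k2 [h1 h2] [].
  rewrite /parallel /GRing.scale/= => e1 e2 e3 e4.
  have b0 : b != 0 by rewrite -sqrf_eq0 ba sqrf_eq0 gt_eqF.
  have kh1 : h1 - k1 = 0.
    have b2 : b + b != 0 by apply: contra_neq b0; lra.
    by apply: (mulIf b2); move: e4; rewrite opprK subrr mulr0 mul0r.
  have kh2 : h2 = - k2 by lra.
  exists k2; last by split; congr pair; lra.
  by move: e3; rewrite kh2 -ba (_ : k1 = h1); [nra|lra].
case: fKH => fK fH.
have figE : circular_segment O r s t `|` triangle K O H = f @^-1` std_figure a c r.
  rewrite circular_segment_frame//; last by rewrite -/d; lra.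
  rewrite (frame_triangle O m) -/m -/d -/f fK fH (frame_origin O m : f O = 0).
  by rewrite triangle_std// -preimage_setU.
rewrite figE.
(* The inverse of the frame sends the barycenter [0] to [O]. *)
have := is_barycenter_preimage f O 0 _ _ _ _ _ (area_preserving_frame O m)
  (frameK O m) (is_barycenter_std_figure a c r a0 c0 r_gt0 car).
by rewrite /= !mulr0 !addr0 -surjective_pairing.
Qed.
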